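(* Let $(\mathcal{X},d)$ be a metric space, let $S\subseteq\mathcal{X}$ be a finite set with $|S|=n$, and let $n_0\ge 1$ be an integer with $n_0<n$. Suppose that $S$ satisfies the strong expansion rate condition with constant $\tilde c\ge 1$ (with respect to $n_0$). Then for any $\epsilon>0$, with probability at least $1-\epsilon$ over the random choice of pivots, the comparison tree construction with input $S$ and maximum leaf size $n_0$ returns a tree of height smaller than $$h^* = 3\log\left(\frac{e}{\epsilon}\right)+96\,\tilde c^{2}\log\left(\frac{n}{n_0}\right).$$
   Context: $\log$ is the natural logarithm; $B(x,r)$ is the closed ball in $(\mathcal{X},d)$ with center $x$ and radius $r$. Comparison tree construction (input: finite set $S$, maximum leaf size $n_0$). The root is $S$. A node $A$ with $|A|\le n_0$ is a leaf. A node $A$ with $|A|>n_0$ is split: an ordered pair of distinct points $x_1,x_2\in A$ (left and right pivot) is drawn uniformly at random, the left child is $\{x\in A: d(x,x_1)\le d(x,x_2)\}$ and the right child is the remaining set $\{x\in A: d(x,x_1)>d(x,x_2)\}$; the procedure recurses on both children, with independent randomness. The root has depth $1$, and the children of a node of depth $j$ have depth $j+1$. The height of the tree is the maximum depth of a node (so the height exceeds $h$ if and only if there is a node at depth $h$ with more than $n_0$ elements). The collection $\mathcal{C}_S$. Take the smallest collection of subsets of $S$ such that (1) $S$ belongs to it; (2) for all $x,y\in S$, the set $A=\{z\in S: d(z,x)\le d(z,y)\}$ and its complement $S\setminus A$ belong to it; (3) it is closed under pairwise intersections. Then remove all sets with at most $n_0$ elements; the result is $\mathcal{C}_S$. Strong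 expansion rate. $S$ satisfies the strong expansion rate condition with constant $\tilde c\ge 1$ if $|B(x,2r)\cap A|\le \tilde c\,|B(x,r)\cap A|$ for all $A\in\mathcal{C}_S$, all $x\in A$ and all $r>0$. *)

(* Defs.v *)
From mathcomp Require Import all_boot all_order all_algebra finmap.
From mathcomp Require Import all_classical all_reals all_analysis.

Set Implicit Arguments.
Unset Strict Implicit.
Unset Printing Implicit Defensive.

Import Order.TTheory GRing.Theory Num.Theory.
Local Open Scope ring_scope.
Local Open Scope fset_scope.

Section FiniteLaws.
Variable R : realType.

(* A finitely supported law, as a list of outcomes with their weights; an
   outcome may be listed several times, its probability being the sum of its
   weights. *)
Definition law (T : Type) := seq (R * T).

Definition prob (T : Type) (mu : law T) (E : pred T) : R :=
  \sum_(p <- mu | E p.2) p.1.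

Definition law_ret (T : Type) (x : T) : law T := [:: (1, x)].

(* Draw x from mu, then draw from k x with fresh randomness. *)
Definition law_bind (T U : Type) (mu : law T) (k : T -> law U) : law U :=
  flatten [seq [seq (p.1 * q.1, q.2) | q <- k p.2] | p <- mu].

Definition uniform_law (T : choiceType) (A : {fset T}) : law T :=
  [seq ((#|` A|)%:R^-1, x) | x <- enum_fset A].

End FiniteLaws.

Section ComparisonTrees.
Variables (R : realType) (X : metricType R).
Implicit Types (A B S : {fset X}) (x y : X).

(* [Node A x1 x2 l r]: node A, left and right pivots x1 and x2, subtrees l, r. *)
Inductive ctree : Type :=
| Leaf of {fset X}
| Node of {fset X} & X & X & ctree & ctree.

Fixpoint depths (j : nat) (t : ctree) : seq nat :=
  match t with
  | Leaf _ => [:: j]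
  | Node _ _ _ l r => j :: depths j.+1 l ++ depths j.+1 r
  end.

Definition height (t : ctree) : nat := \max_(j <- depths 1 t) j.

Definition closer A x y : {fset X} := [fset z in A | mdist z x <= mdist z y].

Definition pivots A : {fset X * X} := [fset p in A `*` A | p.1 != p.2].

(* The argument k bounds the number of nested calls. If it is exhausted, the
   result is the null law, which gives every event probability 0. Both children
   are smaller than A, so k = #|` A| is enough: see [comparison_treeE] and
   [prob_comparison_tree] below. *)
Fixpoint comparison_tree_rec (n0 k : nat) A : law R ctree :=
  if (#|` A| <= n0)%N then law_ret R (Leaf A) else
  if k is k'.+1 then
    law_bind (uniform_law R (pivots A)) (fun p =>
    law_bind (comparison_tree_rec n0 k' (closer A p.1 p.2)) (fun l =>
    law_bind (comparison_tree_rec n0 k' (A `\` closer A p.1 p.2)) (fun r =>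
    law_ret R (Node A p.1 p.2 l r))))
  else [::].

Definition comparison_tree (n0 : nat) S : law R ctree :=
  comparison_tree_rec n0 #|` S| S.

Inductive generated S : {fset X} -> Prop :=
| generated_full : generated S S
| generated_closer x y : x \in S -> y \in S -> generated S (closer S x y)
| generated_farther x y :
    x \in S -> y \in S -> generated S (S `\` closer S x y)
| generated_cap A B : generated S A -> generated S B -> generated S (A `&` B).

Definition collection (n0 : nat) S A : Prop :=
  generated S A /\ (n0 < #|` A|)%N.

(* Points of A in the closed ball {z | d(x, z) <= r}. The library's
   [closed_ball] is the closure of the open ball, which can be smaller. *)
Definition ball_in A x (r : R) : {fset X} := [fset z in A | mdist x z <= r].

Definition strong_expansion_rate (n0 : nat) S (c : R) : Prop :=
  forall A x (r : R), collection n0 S A -> x \in A -> 0 < r ->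
    (#|` ball_in A x (2 * r)|)%:R <= c * (#|` ball_in A x r|)%:R.

Lemma height_Leaf A : height (Leaf A) = 1%N.
Proof. by rewrite /height /= big_seq1. Qed.

Lemma height_Node A x y (l r : ctree) :
  height (Node A x y l r) = (maxn (height l) (height r)).+1.
Proof.
have shift (t : ctree) j :
    (\max_(i <- depths j.+1 t) i = (\max_(i <- depths j t) i).+1)%N.
  elim: t j => [B|B u v s IHs t IHt] j /=; first by rewrite !big_seq1.
  by rewrite !big_cons !big_cat /= !IHs !IHt !maxnSS.
rewrite /height /= big_cons big_cat /= !shift maxnSS.
by rewrite (maxn_idPr _).
Qed.

Lemma mem_closer A x y z :
  (z \in closer A x y) = (z \in A) && (mdist z x <= mdist z y).
Proof. by rewrite !inE. Qed.

Lemma mem_pivots A p :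
  (p \in pivots A) = [&& p.1 \in A, p.2 \in A & p.1 != p.2].
Proof. by rewrite !inE /= andbA. Qed.

Lemma card_closer A p : p \in pivots A ->
  (#|` closer A p.1 p.2| < #|` A|)%N /\
  (#|` A `\` closer A p.1 p.2| < #|` A|)%N.
Proof.
rewrite mem_pivots => /and3P[p1A p2A p12]; split; apply: fproper_ltn_card;
  rewrite fproperEneq.
- rewrite fset_sub andbT; apply/eqP => /fsetP /(_ p.2).
  by rewrite mem_closer p2A mdistxx leNgt mdist_gt0 eq_sym p12.
- rewrite fsubsetDl andbT; apply/eqP => /fsetP /(_ p.1).
  by rewrite in_fsetD mem_closer p1A mdistxx mdist_ge0.
Qed.

Lemma pivots_neq0 A : (1 < #|` A|)%N -> pivots A != fset0.
Proof.
move=> A1; have /fset0Pn[x xA] : A != fset0 by rewrite -cardfs_gt0 ltnW.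
have /fset0Pn[y] : A `\ x != fset0.
  by rewrite -cardfs_gt0; move: A1; rewrite (cardfsD1 x) xA.
rewrite in_fsetD1 => /andP[yx yA].
by apply/fset0Pn; exists (x, y); rewrite mem_pivots /= xA yA eq_sym.
Qed.

Lemma eq_law_bind (T : choiceType) (U : Type) (P : {fset T})
    (k1 k2 : T -> law R U) :
  {in P, k1 =1 k2} ->
  law_bind (uniform_law R P) k1 = law_bind (uniform_law R P) k2.
Proof.
move=> k12; rewrite /law_bind -!map_comp; congr flatten.
by apply/eq_in_map => x /k12 /= ->.
Qed.

Lemma comparison_tree_recE n0 k A : (#|` A| <= k)%N ->
  comparison_tree_rec n0 k A = comparison_tree n0 A.
Proof.
have [m] := ubnP #|` A|; elim: m => // m IH in k A *.
rewrite ltnS /comparison_tree.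
case cA: #|` A| => [|a] am ak.
  by case: k ak => [//|k] _ /=; rewrite cA.
case: k ak => // k ak /=; rewrite cA; case: ifP => // _.
apply: eq_law_bind => p /card_closer[]; rewrite cA !ltnS => lA rA.
have {}IH j B : (#|` B| <= a)%N -> (a <= j)%N ->
    comparison_tree_rec n0 j B = comparison_tree n0 B.
  by move=> Ba aj; apply: IH; [apply: leq_ltn_trans am | apply: leq_trans aj].
by rewrite !(IH k) // !(IH a).
Qed.

(* The recursive equation defining the construction. *)
Lemma comparison_treeE n0 A :
  comparison_tree n0 A =
  if (#|` A| <= n0)%N then law_ret R (Leaf A) else
    law_bind (uniform_law R (pivots A)) (fun p =>
    law_bind (comparison_tree n0 (closer A p.1 p.2)) (fun l =>
    law_bind (comparison_tree n0 (A `\` closer A p.1 p.2)) (fun r =>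
    law_ret R (Node A p.1 p.2 l r)))).
Proof.
rewrite {1}/comparison_tree; case cA: #|` A| => [|a]; first by rewrite /= cA.
rewrite /= cA; case: ifP => // _.
apply: eq_law_bind => p /card_closer[]; rewrite cA !ltnS => lA rA.
by rewrite !comparison_tree_recE.
Qed.

Lemma prob_law_bind (T U : Type) (mu : law R T) (k : T -> law R U) E :
  prob (law_bind mu k) E = \sum_(p <- mu) p.1 * prob (k p.2) E.
Proof.
rewrite /prob /law_bind big_flatten big_map; apply: eq_bigr => p _.
by rewrite big_map mulr_sumr.
Qed.

Lemma prob_uniform_law (T : choiceType) (P : {fset T}) : P != fset0 ->
  prob (uniform_law R P) xpredT = 1.
Proof.
move=> P0; rewrite /prob big_map /= big_const_seq count_predT iter_addr_0.
by rewrite -[_ *+ _]mulr_natr mulVf ?pnatr_eq0 ?cardfs_eq0.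
Qed.

Lemma prob_comparison_tree n0 A : (0 < n0)%N ->
  prob (comparison_tree n0 A) xpredT = 1.
Proof.
move=> n00; have [m] := ubnP #|` A|; elim: m => // m IH in A *.
rewrite ltnS => Am; rewrite comparison_treeE; case: ifP => [_|/negbT].
  by rewrite /prob big_seq1.
rewrite -ltnNge => /(leq_ltn_trans n00) A1.
have step (T U : Type) (mu : law R T) (k : T -> law R U) :
    prob mu xpredT = 1 -> (forall u, prob (k u) xpredT = 1) ->
    prob (law_bind mu k) xpredT = 1.
  by move=> mu1 k1; rewrite prob_law_bind -mu1; apply: eq_bigr => p _;
     rewrite k1 mulr1.
rewrite prob_law_bind -(prob_uniform_law (pivots_neq0 A1)) /prob !big_map.
apply: eq_big_seq => p /card_closer[lA rA]; rewrite -[RHS]mulr1; congr (_ * _).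
apply: (step) => [|l]; first by apply: IH; rewrite (leq_trans lA).
apply: (step) => [|r]; first by apply: IH; rewrite (leq_trans rA).
by rewrite /prob big_seq1.
Qed.

End ComparisonTrees.

(* Main.v *)
(** For an exponent s between 16 c^2 and 32 c^2, follow the potential
    sum (|A| / n0)^s over the nodes A of a given depth with more than n0
    points; it is at least 1 whenever there is such a node.  A split never
    increases it.  Seen from either pivot, the other one is among the nearest
    quarter of A with probability at most 1/4; if this happens on neither side,
    two applications of the expansion condition give both children at least
    |A| / (4 c^2) points, so that the contribution of A drops by a factor at
    least 8 since 2 (1 - 1 / (4 c^2))^s <= 2 exp(-4) <= 1/8.  The expected
    factor of a split is thus at most 1/4 + 1/4 + 1/8 < 2/3 <= exp(-1/3), a
    constant free of c: this is why only log(n / n0) is multiplied by c^2. *)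

Require Import Defs.
From mathcomp Require Import all_boot all_order all_algebra finmap.
From mathcomp Require Import all_classical all_reals all_analysis.
From mathcomp Require Import zify ring lra.

Import Order.TTheory GRing.Theory Num.Theory.
Local Open Scope ring_scope.

(** * Pivot pairs: frequency of close pairs, balance of the others *)

(** The bad event seen from the first pivot. It is not symmetric in the pair; the view from the
    second pivot is [short_pair A (p.2, p.1)]. *)
Definition short_pair {R : realType} {X : metricType R} (A : {fset X})
    (p : X * X) : bool :=
  (4 * #|` ball_in A p.1 (mdist p.1 p.2)| <= #|` A|)%N.

Lemma mem_ball_in (R : realType) (X : metricType R) (A : {fset X}) (x z : X)
    (r : R) :
  (z \in ball_in A x r) = (z \in A) && (mdist x z <= r).
Proof. by rewrite !inE. Qed.

Lemma sum_pivots (R : realType) (X : metricType R) (A : {fset X})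
    (F : X * X -> nat) :
  (\sum_(p <- pivots A) F p =
   \sum_(x <- A) \sum_(y <- A | x != y) F (x, y))%N.
Proof.
under [RHS]eq_bigr => x _ do rewrite big_mkcond.
rewrite -[RHS](@big_allpairs _ _ _ _ _ _ _
  (fun p => if p.1 != p.2 then F p else 0%N)).
rewrite -[RHS]big_mkcond -[RHS]big_filter; apply: perm_big; apply: uniq_perm.
- exact: fset_uniq.
- by rewrite filter_uniq // allpairs_uniq ?fset_uniq // => -[? ?] [? ?].
- case=> x y; rewrite mem_filter mem_pivots [RHS]andbC andbA; congr andb.
  apply/andP/allpairsP => /= [[xA yA]|[[u v] /= [uA vA [-> ->]]]//].
  by exists (x, y).
Qed.

(* Together with x, the points y with short_pair A (x, y) all lie in the ball
   about x through the farthest of them. *)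
Lemma short_pair_row (R : realType) (X : metricType R) (A : {fset X}) (x : X) :
  x \in A ->
  (4 * \sum_(y <- A | x != y) short_pair A (x, y)
    <= \sum_(y <- A | x != y) 1)%N.
Proof.
move=> xA; set s := enum_fset A.
have cs (P Q : pred X) : (\sum_(y <- s | P y) Q y = count (predI P Q) s)%N.
  by rewrite -big_mkcondr /= sum1_count.
rewrite cs; set P := predI _ _.
have [/hasP[y0 y0A Py0]|/negbTE] := boolP (has P s); last first.
  by rewrite has_count lt0n => /negbFE/eqP ->.
pose i0 : A := [` y0A]%fset.
have [[y yA] /= Py ymax] := @arg_maxP _ R A i0 (fun i => P (val i))
  (fun i => mdist x (val i)) Py0.
have uB : uniq (x :: [seq z <- s | P z]) by
  rewrite /= mem_filter /P /= eqxx /= filter_uniq// fset_uniq.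
have sB : {subset x :: [seq z <- s | P z]
                 <= enum_fset (ball_in A x (mdist x y))}.
  move=> z; rewrite inE => /orP[/eqP ->|].
    by rewrite mem_ball_in xA mdistxx mdist_ge0.
  rewrite mem_filter => /andP[Pz zA]; rewrite mem_ball_in zA.
  exact: (ymax [` zA]%fset Pz).
(* [x] fails [P] but lies in the ball; this extra point makes up for the row having only |A| - 1
   entries. *)
have le : (count P s < #|` ball_in A x (mdist x y)|)%N.
  by rewrite -size_filter; exact: uniq_leq_size uB sB.
have Bm : (4 * #|` ball_in A x (mdist x y)| <= #|` A|)%N by case/andP: Py.
have -> : (\sum_(y <- s | x != y) 1 = #|` A|.-1)%N.
  rewrite sum1_count (cardfsD1 x) xA /= -size_filter.
  apply: perm_size; apply: uniq_perm; rewrite ?filter_uniq ?fset_uniq//.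
  by move=> z; rewrite mem_filter in_fsetD1 eq_sym.
by lia.
Qed.

Lemma short_pair_pivots (R : realType) (X : metricType R) (A : {fset X}) :
  (4 * \sum_(p <- pivots A) short_pair A p <= #|` pivots A|)%N.
Proof.
rewrite -sum1_size !sum_pivots big_distrr /= !big_seq.
by apply: leq_sum => x; exact: short_pair_row.
Qed.

(** Reversing pairs permutes the pivots. *)
Lemma short_pair_swap (R : realType) (X : metricType R) (A : {fset X}) :
  (4 * \sum_(p <- pivots A) short_pair A (p.2, p.1) <= #|` pivots A|)%N.
Proof.
suff -> : (\sum_(p <- pivots A) short_pair A (p.2, p.1) =
           \sum_(p <- pivots A) short_pair A p)%N by exact: short_pair_pivots.
rewrite !sum_pivots (exchange_big_dep xpredT) //=.
by apply: eq_bigr => x _; apply: eq_bigl => y; rewrite eq_sym.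
Qed.

(* The balls of radius d(x1, x2) / 4 about the pivots lie
   inside the respective children. *)
Lemma long_pair_children (R : realType) (X : metricType R) (S A : {fset X})
    (n0 : nat) (c : R) (p : X * X) :
  1 <= c -> strong_expansion_rate n0 S c -> collection n0 S A ->
  p \in pivots A -> ~~ short_pair A p -> ~~ short_pair A (p.2, p.1) ->
  #|` A|%:R <= 4 * c ^+ 2 * #|` closer A p.1 p.2|%:R /\
  #|` A|%:R <= 4 * c ^+ 2 * #|` (A `\` closer A p.1 p.2)%fset|%:R.
Proof.
move=> c1 Sc AS pA; have := pA; rewrite mem_pivots => /and3P[p1A p2A p12].
rewrite /short_pair /= (metric_sym p.2 p.1) -!ltnNge.
set r := mdist p.1 p.2 => l1 l2.
have r0 : 0 < r by rewrite mdist_gt0.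
(* Doubling from r/4 to r/2 to r costs a factor [c] each time; the 4 comes from the pair not being
   short. *)
have quarter x : x \in A -> (#|` A| < 4 * #|` ball_in A x r|)%N ->
    #|` A|%:R <= 4 * c ^+ 2 * #|` ball_in A x (r / 4)|%:R.
  move=> xA; rewrite -(ltr_nat R) natrM => lx.
  have h1 := Sc A x (r / 2) AS xA ltac:(lra).
  have h2 := Sc A x (r / 4) AS xA ltac:(lra).
  rewrite (_ : 2 * (r / 2) = r) in h1; last by lra.
  rewrite (_ : 2 * (r / 4) = r / 2) in h2; last by lra.
  have h3 : c * #|` ball_in A x (r / 2)|%:R <=
            c * (c * #|` ball_in A x (r / 4)|%:R).
    by apply: ler_wpM2l => //; lra.
  by rewrite expr2 -!mulrA; lra.
have c2 : 0 <= 4 * c ^+ 2 by rewrite mulr_ge0 ?sqr_ge0.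
split.
  apply: le_trans (quarter _ p1A l1) _; apply: ler_wpM2l => //.
  rewrite ler_nat; apply: fsubset_leq_card; apply/fsubsetP => z.
  rewrite mem_ball_in mem_closer => /andP[-> /= zr].
  have := metric_triangle p.1 z p.2; rewrite -/r (metric_sym z p.1); lra.
apply: le_trans (quarter _ p2A l2) _; apply: ler_wpM2l => //.
rewrite ler_nat; apply: fsubset_leq_card; apply/fsubsetP => z.
rewrite mem_ball_in in_fsetD mem_closer => /andP[-> /= zr].
(* The right child needs a strict inequality: [z] is within r/4 of [p.2], so at least 3r/4 from
   [p.1], and r > 0. *)
rewrite andbT -ltNge.
have := metric_triangle p.1 z p.2.
rewrite -/r (metric_sym z p.1) (metric_sym z p.2); lra.
Qed.

(** * Expectations and a union bound for finite laws *)

(** A [law] allows arbitrary real weights; this sign condition makes expectations monotone. *)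
Definition nonneg_law {R : realType} {T : Type} (mu : law R T) : bool :=
  all (fun p => 0 <= p.1) mu.

Lemma prob_sum (R : realType) (T : Type) (mu : law R T) (E : pred T) :
  prob mu E = \sum_(p <- mu) p.1 * (E p.2)%:R.
Proof.
rewrite /prob big_mkcond; apply: eq_bigr => p _.
by case: (E p.2); rewrite ?mulr1 ?mulr0.
Qed.

Lemma ler_law_sum (R : realType) (T : Type) (mu : law R T) (F G : T -> R) :
  nonneg_law mu -> (forall x, F x <= G x) ->
  \sum_(p <- mu) p.1 * F p.2 <= \sum_(p <- mu) p.1 * G p.2.
Proof.
move=> mu0 FG; elim: mu mu0 => [|p mu IH] /=; first by rewrite !big_nil.
by case/andP=> p0 mu0; rewrite !big_cons lerD ?IH // ler_wpM2l.
Qed.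

Lemma nonneg_law_bind (R : realType) (T U : Type) (mu : law R T)
    (k : T -> law R U) :
  nonneg_law mu -> (forall x, nonneg_law (k x)) -> nonneg_law (law_bind mu k).
Proof.
move=> mu0 k0; elim: mu mu0 => [//|p mu IH] /= /andP[p0 mu0].
rewrite /nonneg_law /law_bind /= all_cat all_map -/(law_bind mu k).
apply/andP; split; last exact: IH.
by apply: sub_all (k0 p.2) => q q0 /=; rewrite mulr_ge0.
Qed.

Lemma nonneg_comparison_tree (R : realType) (X : metricType R) (n0 : nat)
    (A : {fset X}) :
  nonneg_law (comparison_tree n0 A).
Proof.
rewrite /comparison_tree; move: (#|` A|) => k; elim: k A => [|k IH] A /=.
  by case: ifP => // _; rewrite /nonneg_law /= ler01.
case: ifP => _; first by rewrite /nonneg_law /= ler01.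
apply: nonneg_law_bind => [|p].
  by rewrite /nonneg_law all_map; apply/allP => q _ /=; rewrite invr_ge0 ler0n.
do 2 (apply: nonneg_law_bind => // ?).
by rewrite /nonneg_law /= ler01.
Qed.

(** Union bound on indicators; as both laws have mass 1, averaging out the other draw leaves each
    event its own probability. *)
Lemma prob_bind2_le (R : realType) (T U V : Type) (mu : law R T) (nu : law R U)
    (f : T -> U -> V) (E : pred V) (E1 : pred T) (E2 : pred U) :
  nonneg_law mu -> nonneg_law nu ->
  prob mu xpredT = 1 -> prob nu xpredT = 1 ->
  (forall x y, E (f x y) -> E1 x || E2 y) ->
  prob (law_bind mu (fun x => law_bind nu (fun y => law_ret R (f x y)))) E
    <= prob mu E1 + prob nu E2.
Proof.
move=> mu0 nu0 mu1 nu1 EE; rewrite prob_law_bind.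
have {}mu1 : \sum_(p <- mu) p.1 = 1 by [].
have {}nu1 : \sum_(p <- nu) p.1 = 1 by [].
have -> : prob mu E1 + prob nu E2 =
          \sum_(p <- mu) p.1 * ((E1 p.2)%:R + prob nu E2).
  under eq_bigr do rewrite mulrDr.
  by rewrite big_split /= -prob_sum -mulr_suml mu1 mul1r.
apply: (@ler_law_sum _ _ mu
  (fun x => prob (law_bind nu (fun y => law_ret R (f x y))) E)
  (fun x => (E1 x)%:R + prob nu E2)) => // x.
have -> : (E1 x)%:R + prob nu E2 =
          \sum_(q <- nu) q.1 * ((E1 x)%:R + (E2 q.2)%:R).
  under eq_bigr do rewrite mulrDr.
  by rewrite big_split /= -mulr_suml nu1 mul1r prob_sum.
rewrite prob_law_bind.
apply: (@ler_law_sum _ _ nu (fun y => prob (law_ret R (f x y)) E)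
  (fun y => (E1 x)%:R + (E2 y)%:R)) => // y.
rewrite prob_sum big_seq1 mul1r /= -natrD ler_nat.
by case: (E _) (EE x y) => // /(_ isT); case: (E1 x); case: (E2 y).
Qed.

(** * Decay of the potential under a split *)

(** Splitting [A] amounts to intersecting it with a half of [S], so the expansion condition stays
    available at every node above size [n0]. *)
Lemma generated_child (R : realType) (X : metricType R) (S A : {fset X})
    (p : X * X) :
  generated S A -> p \in pivots A ->
  generated S (closer A p.1 p.2) /\ generated S (A `\` closer A p.1 p.2)%fset.
Proof.
move=> gA; rewrite mem_pivots => /and3P[p1 p2 _].
have sA : (A `<=` S)%fset.
  elim: gA {p1 p2} => [|x y _ _|x y _ _|B C _ BS _ CS] //.
  - exact: fset_sub.
  - exact: fsubsetDl.
  - by apply: fsubset_trans BS; exact: fsubsetIl.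
have eA : A = (A `&` S)%fset by apply/esym/fsetIidPl.
split.
  have -> : closer A p.1 p.2 = (A `&` closer S p.1 p.2)%fset.
    by apply/fsetP => z; rewrite in_fsetI !mem_closer {1}eA in_fsetI andbA.
  apply: generated_cap => //.
  by apply: generated_closer; exact: (fsubsetP sA).
have -> : (A `\` closer A p.1 p.2 = A `&` (S `\` closer S p.1 p.2))%fset.
  apply/fsetP => z; rewrite in_fsetI !in_fsetD !mem_closer.
  by case zA: (z \in A); rewrite ?andbF // (fsubsetP sA _ zA) !andbT.
apply: generated_cap => //.
by apply: generated_farther; exact: (fsubsetP sA).
Qed.

Lemma pow_split (R : realType) (c : R) (s l r m : nat) :
  1 <= c -> 16 * c ^+ 2 <= s%:R -> (l + r = m)%N ->
  m%:R <= 4 * c ^+ 2 * l%:R -> m%:R <= 4 * c ^+ 2 * r%:R ->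
  l%:R ^+ s + r%:R ^+ s <= m%:R ^+ s * 8^-1 :> R.
Proof.
move=> c1 cs lrm ml mr.
have c2 : 1 <= c ^+ 2 by rewrite exprn_ege1.
pose b : R := (4 * c ^+ 2)^-1.
have c4 : 0 < 4 * c ^+ 2 by lra.
have b0 : 0 < b by rewrite invr_gt0.
have b1 : b <= 1 by rewrite invf_le1 //; lra.
(* If one child holds a fraction [b], the other has at most (1 - b) m points; as s b >= 4, its power
   shrinks by exp(-4) <= 2^-4. *)
have small (u v : nat) : (u + v = m)%N -> m%:R <= 4 * c ^+ 2 * v%:R ->
    u%:R ^+ s <= m%:R ^+ s * 16^-1 :> R.
  move=> uvm; rewrite -ler_pdivrMl // -/b => bv.
  have um : u%:R <= m%:R * (1 - b) :> R.
    by move: bv; rewrite -uvm natrD; lra.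
  apply: (@le_trans _ _ ((m%:R * (1 - b)) ^+ s)).
    by rewrite lerXn2r ?nnegrE ?mulr_ge0 //; lra.
  rewrite exprMn ler_wpM2l ?exprn_ge0 //.
  apply: (@le_trans _ _ (expR (- b) ^+ s)).
    by rewrite lerXn2r ?nnegrE ?expR_ge0 ?(expR_ge1Dx (- b)) //; lra.
  rewrite -expRM_natl.
  apply: (@le_trans _ _ (expR (- (4%:R * 1)))).
    rewrite ler_expR mulrN lerN2 mulr1 ler_pdivlMr //; lra.
  rewrite expRN expRM_natl lef_pV2 ?posrE ?exprn_gt0 ?expR_gt0 //.
  have e2 : 2 <= expR 1 :> R by have := expR_ge1Dx (1 : R); lra.
  have -> : 16 = 2 ^+ 4 :> R by rewrite -natrX.
  by rewrite lerXn2r ?nnegrE //; lra.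
have h1 := small l r lrm mr.
have h2 := small r l _ ml; rewrite addnC in h2; have {}h2 := h2 lrm.
lra.
Qed.

Lemma split_moment (R : realType) (X : metricType R) (S A : {fset X})
    (n0 s : nat) (c : R) :
  1 <= c -> strong_expansion_rate n0 S c -> collection n0 S A ->
  (0 < n0)%N -> 16 * c ^+ 2 <= s%:R ->
  \sum_(p <- pivots A) ((#|` closer A p.1 p.2|)%:R ^+ s
                        + (#|` (A `\` closer A p.1 p.2)%fset|)%:R ^+ s)
    <= (#|` pivots A|)%:R * ((#|` A|)%:R ^+ s * (2 / 3)) :> R.
Proof.
move=> c1 Sc AS n00 cs.
set M := (#|` A|)%:R ^+ s.
have M0 : 0 <= M by rewrite exprn_ge0.
have c2 : 1 <= c ^+ 2 by rewrite exprn_ege1.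
have s0 : (0 < s)%N by rewrite -(ltr_nat R); lra.
(* Every split is charged M/8 and each short side a further [M]; the average is at most (1/8 + 1/4 +
   1/4) M = 5/8 M. *)
apply: (@le_trans _ _ (\sum_(p <- pivots A)
   (M * 8^-1 + M * ((short_pair A p)%:R + (short_pair A (p.2, p.1))%:R)))).
  rewrite big_seq [leRHS]big_seq; apply: ler_sum => p pA.
  have lrm :
    (#|` closer A p.1 p.2| + #|` (A `\` closer A p.1 p.2)%fset| = #|` A|)%N.
    by rewrite -(cardfsID (closer A p.1 p.2) A) (fsetIidPr _) ?fset_sub.
  have [sh|lg] := boolP (short_pair A p || short_pair A (p.2, p.1)).
    apply: (@le_trans _ _ M).
      (* Superadditivity of the power: peel off one factor and bound the remaining s - 1 by those of
         the sum. *)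
      rewrite /M -lrm natrD -(prednK s0) !exprS mulrDl.
      rewrite lerD // ler_wpM2l //;
        by rewrite lerXn2r ?nnegrE ?addr_ge0 // ?lerDl ?lerDr.
    have : 1 <= (short_pair A p)%:R + (short_pair A (p.2, p.1))%:R :> R.
      by rewrite -natrD ler1n; case: (short_pair A p) sh => //= ->.
    by nra.
  move: lg; rewrite negb_or => /andP[lg1 lg2].
  have [hl hr] := long_pair_children _ _ _ _ _ _ _ c1 Sc AS pA lg1 lg2.
  apply: le_trans (pow_split _ _ _ _ _ _ c1 cs lrm hl hr) _.
  by rewrite lerDl mulr_ge0 // addr_ge0.
rewrite big_split /= big_const_seq count_predT iter_addr_0 -mulr_sumr big_split.
rewrite /= -!natr_sum -mulr_natr.
have := short_pair_pivots _ _ A; have := short_pair_swap _ _ A.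
rewrite -!(ler_nat R) !natrM.
set u := (\sum_(p <- _) _)%:R; set v := (\sum_(p <- _) _)%:R.
set P := (#|` pivots A|)%:R.
have P0 : 0 <= P by rewrite ler0n.
rewrite -/P => h1 h2.
by nra.
Qed.

(** * Tail of the height *)

(** Depth h + 1 is reached after h splits, hence the exponent [h]. Induction from the root: the
    union bound adds the bounds of the two children, and [split_moment] averages them over the
    pivots. *)
Lemma deep_prob (R : realType) (X : metricType R) (S A : {fset X})
    (n0 s h : nat) (c : R) :
  1 <= c -> strong_expansion_rate n0 S c -> generated S A ->
  (0 < n0)%N -> 16 * c ^+ 2 <= s%:R ->
  prob (comparison_tree n0 A) (fun t => (h.+1 < height t)%N)
    <= ((#|` A|)%:R / n0%:R) ^+ s * (2 / 3) ^+ h :> R.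
Proof.
move=> c1 Sc + n00 cs; elim: h A => [|h IH] A gA.
all: have [An|An0] := leqP (#|` A|) n0.
1,3: rewrite comparison_treeE An prob_sum big_seq1 /= height_Leaf /= mulr0.
1,2: by rewrite mulr_ge0 ?exprn_ge0 ?divr_ge0.
  (* Above size [n0] the potential is at least 1, which bounds any probability. *)
  rewrite expr0 mulr1 (@le_trans _ _ 1) //.
    rewrite -(prob_comparison_tree A n00) !prob_sum.
    apply: (@ler_law_sum _ _ _ (fun t => (1 < height t)%N%:R) (fun=> 1%:R)).
      exact: nonneg_comparison_tree.
    by move=> t; rewrite ler_nat leq_b1.
  rewrite exprn_ege1 // ler_pdivlMr ?ltr0n // mul1r ler_nat; exact: ltnW.
rewrite comparison_treeE leqNgt An0 /=.
have AS : collection n0 S A by [].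
rewrite prob_law_bind big_map /=.
set P := #|` pivots A|.
have P0 : 0 < P%:R :> R.
  by rewrite ltr0n cardfs_gt0 pivots_neq0 // (leq_ltn_trans _ An0).
pose g (B : {fset X}) : R := (#|` B|)%:R ^+ s.
pose K : R := (n0%:R ^+ s)^-1 * (2 / 3) ^+ h.
have K0 : 0 <= K by rewrite mulr_ge0 ?invr_ge0 ?exprn_ge0.
apply: (@le_trans _ _ (\sum_(p <- pivots A)
   (P%:R^-1 * K) * (g (closer A p.1 p.2) + g (A `\` closer A p.1 p.2)%fset))).
  rewrite big_seq [leRHS]big_seq; apply: ler_sum => p pA.
  rewrite -mulrA ler_wpM2l ?invr_ge0 ?ler0n //.
  have [gl gr] := generated_child _ _ _ _ _ gA pA.
  apply: le_trans (prob_bind2_le _ _ _ _ _ _ _ _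
    (fun t => h.+1 < height t)%N (fun t => h.+1 < height t)%N _ _ _ _ _) _.
  - exact: nonneg_comparison_tree.
  - exact: nonneg_comparison_tree.
  - exact: prob_comparison_tree.
  - exact: prob_comparison_tree.
  - by move=> l r /=; rewrite height_Node ltnS leq_max.
  apply: le_trans (lerD (IH _ gl) (IH _ gr)) _.
  rewrite ![(_ / n0%:R) ^+ s]expr_div_n -mulrDl -mulrDl /K /g.
  by rewrite -mulrA mulrC.
rewrite -mulr_sumr.
apply: le_trans (ler_wpM2l _ (split_moment _ _ _ _ _ _ _ c1 Sc AS n00 cs)) _.
  by rewrite mulr_ge0 ?invr_ge0 ?ler0n.
rewrite /K exprS [(_ / n0%:R) ^+ s]expr_div_n -/P.
set M := (#|` A|)%:R ^+ s; set N := n0%:R ^- s; set Q := _ ^+ h.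
have -> : P%:R^-1 * (N * Q) * (P%:R * (M * (2 / 3))) =
          (P%:R^-1 * P%:R) * (M * N * (2 / 3 * Q)) by ring.
by rewrite mulVf ?mul1r // gt_eqF.
Qed.

Lemma exprn_two_thirds (R : realType) (h : nat) :
  (2 / 3) ^+ h <= expR (h%:R * - 3^-1) :> R.
Proof.
rewrite expRM_natl lerXn2r ?nnegrE ?expR_ge0 ?divr_ge0 //.
by have := expR_ge1Dx (- 3^-1 : R); lra.
Qed.

Theorem theorem1 (R : realType) (X : metricType R) (S : {fset X})
    (n n0 : nat) (c : R)
    (cardS : #|` S| = n) (n0_ge1 : (1 <= n0)%N) (n0_lt_n : (n0 < n)%N)
    (c_ge1 : 1 <= c) (S_expansion : strong_expansion_rate n0 S c)
    (eps : R) (eps_gt0 : 0 < eps) :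
  1 - eps <=
  prob (comparison_tree n0 S)
    (fun t => (height t)%:R
              < 3 * ln (expR 1 / eps) + 96 * c ^+ 2 * ln (n%:R / n0%:R)).
Proof.
set E := (fun _ => _).
have mu0 := @nonneg_comparison_tree R X n0 S.
have mu1 := prob_comparison_tree S n0_ge1.
(* The bound is trivial for eps >= 1; otherwise -ln eps > 0, which makes [hstar] at least 3. *)
have [eps1|eps1] := leP 1 eps.
  apply: (@le_trans _ _ 0); first by lra.
  rewrite prob_sum -[leLHS](_ : \sum_(p <- comparison_tree n0 S) p.1 * 0 = 0).
    exact: (@ler_law_sum _ _ _ (fun=> 0) (fun t => (E t)%:R)).
  by rewrite big1 // => p _; rewrite mulr0.
set hstar := 3 * _ + _ in E *.
pose L := - ln eps.
have L0 : 0 < L by rewrite oppr_gt0 ln_lt0 // eps_gt0 eps1.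
pose q : R := n%:R / n0%:R.
have q1 : 1 < q by rewrite ltr_pdivlMr ?ltr0n // mul1r ltr_nat.
have q0 : 0 < q by lra.
have lq0 : 0 < ln q by rewrite ln_gt0.
have c2 : 1 <= c ^+ 2 by rewrite exprn_ege1.
have hE : hstar = 3 + 3 * L + 96 * c ^+ 2 * ln q.
  rewrite /hstar ln_div ?posrE ?expR_gt0 // expRK /L -/q; lra.
have hge3 : 3 <= hstar.
  have : 0 <= 96 * c ^+ 2 * ln q by rewrite mulr_ge0 ?ltW //; lra.
  by rewrite hE; lra.
(* An integer exponent suffices: s > 32 c^2 - 1 >= 16 c^2 because c >= 1. *)
pose s := Num.trunc (32 * c ^+ 2).
have /andP[s_le s_gt] : s%:R <= 32 * c ^+ 2 < s.+1%:R.
  by apply: truncn_itv; lra.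
have /andP[k_le k_gt] :
    (Num.trunc hstar)%:R <= hstar < (Num.trunc hstar).+1%:R.
  by apply: truncn_itv; lra.
have k2 : (2 < Num.trunc hstar)%N.
  by rewrite -(ltr_nat R); move: k_gt; rewrite -natr1; lra.
(* With h + 2 the integer part of [hstar], height at most h + 1 is strictly below [hstar], and h >
   hstar - 3. *)
have [h hk] : exists h, Num.trunc hstar = h.+2.
  by case: (Num.trunc hstar) k2 => [|[|h]] // _; exists h.
rewrite hk in k_gt.
have cs : 16 * c ^+ 2 <= s%:R by move: s_gt; rewrite -natr1; lra.
have deep := deep_prob R X S S n0 s h c c_ge1 S_expansion (generated_full S)
  n0_ge1 cs.
have tail : (#|` S|%:R / n0%:R) ^+ s * (2 / 3) ^+ h <= eps.
  rewrite cardS -/q.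
  have -> : q ^+ s = expR (s%:R * ln q) by rewrite expRM_natl lnK ?posrE.
  apply: le_trans (ler_wpM2l (expR_ge0 _) (exprn_two_thirds _ h)) _.
  (* The summand 3 = 3 ln e of [hstar] pays for the rounding: h/3 > 32 c^2 ln q - ln eps, so the
     exponent is at most ln eps. *)
  rewrite -expRD -[leRHS]lnK ?posrE // ler_expR.
  have : s%:R * ln q <= 32 * c ^+ 2 * ln q by rewrite ler_wpM2r // ltW.
  move: k_gt; rewrite -natr1 -natr1 -natr1 hE /L; lra.
suff : 1 - prob (comparison_tree n0 S) (fun t => (h.+1 < height t)%N)
    <= prob (comparison_tree n0 S) E by lra.
rewrite lerBlDr -mu1 !prob_sum -big_split /=.
under [leRHS]eq_bigr do rewrite -mulrDr.
apply: (@ler_law_sum _ _ _ (fun=> 1)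
  (fun t => (E t)%:R + (h.+1 < height t)%N%:R)) => // t.
rewrite -natrD ler1n addn_gt0 !lt0b /E orbC; case: ltnP => //= th.
by apply: lt_le_trans k_le; rewrite ltr_nat hk ltnS.
Qed.
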